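(* Let $\alpha,\beta\in\mathcal{PL}$, let $k\ge 0$ and let $p_1,\dots,p_{k+1},q_1,\dots,q_{k+1}$ be propositional symbols. Then (i) $(p_1\dots p_{k+1};\alpha)\subseteq(q_1\dots q_{k+1};\beta)\ \equiv\ \big((p_1\dots p_k;\alpha\wedge p_{k+1})\subseteq(q_1\dots q_k;\beta\wedge q_{k+1})\big)\wedge\big((p_1\dots p_k;\alpha\wedge\neg p_{k+1})\subseteq(q_1\dots q_k;\beta\wedge\neg q_{k+1})\big)$; (ii) $(p_1\dots p_{k+1};\alpha)\mid(q_1\dots q_{k+1};\beta)\ \equiv\ \big((p_1\dots p_k;\alpha\wedge p_{k+1})\mid(q_1\dots q_k;\beta\wedge q_{k+1})\big)\wedge\big((p_1\dots p_k;\alpha\wedge\neg p_{k+1})\mid(q_1\dots q_k;\beta\wedge\neg q_{k+1})\big)$.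
   Context: $\mathcal{PL}$ is ordinary propositional logic with formulas $\phi::=p\mid\neg p\mid(\phi\wedge\phi)\mid(\phi\vee\phi)$. A team $T$ over a finite set $\mathrm{Var}(T)$ of propositional symbols is a set of evaluations $s:\mathrm{Var}(T)\to\{0,1\}$. For a single evaluation $s$ and $\alpha\in\mathcal{PL}$, $s\models\alpha$ is ordinary propositional satisfaction. For $\bar p=p_1\dots p_k$, $s(\bar p)=s(p_1)\dots s(p_k)$. For sequences $\bar p,\bar q$ of propositional symbols of the same length (possibly empty) and $\alpha,\beta\in\mathcal{PL}$, the relativized inclusion and exclusion atoms have semantics: $T\models(\bar p;\alpha)\subseteq(\bar q;\beta)$ iff for all $s\in T$, if $s\models\alpha$ then there is $s'\in T$ with $s'(\bar q)=s(\bar p)$ and $s'\models\beta$; $T\models(\bar p;\alpha)\mid(\bar q;\beta)$ iff for all $s,s'\in T$, if $s\models\alpha$ and $s'\models\beta$, then $s(\bar p)\ne s'(\bar q)$. $T\models\phi\wedge\psi$ iff $T\models\phi$ and $T\models\psi$. $\phi\equiv\psi$ means that $\phi$ and $\psi$ have the same free symbols and $T\models\phi\iff T\models\psi$ for every team $T$ whose domain contains these symbols. *)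

(* Defs.v *)
From HB Require Import structures.
From mathcomp Require Import all_boot finmap.

Set Implicit Arguments.
Unset Strict Implicit.
Unset Printing Implicit Defensive.

Local Open Scope fset_scope.

Inductive pl (Sym : choiceType) : Type :=
  | PVar of Sym
  | PNVar of Sym
  | PAnd of pl Sym & pl Sym
  | POr of pl Sym & pl Sym.

(* The sequences of an atom may be empty, but have a common length k. *)
Inductive form (Sym : choiceType) : Type :=
  | Incl (k : nat) of k.-tuple Sym & pl Sym & k.-tuple Sym & pl Sym
  | Excl (k : nat) of k.-tuple Sym & pl Sym & k.-tuple Sym & pl Sym
  | And of form Sym & form Sym.

Fixpoint pl_syms (Sym : choiceType) (a : pl Sym) : {fset Sym} :=
  match a with
  | PVar p => [fset p]
  | PNVar p => [fset p]
  | PAnd a1 a2 => pl_syms a1 `|` pl_syms a2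
  | POr a1 a2 => pl_syms a1 `|` pl_syms a2
  end.

Fixpoint free_syms (Sym : choiceType) (f : form Sym) : {fset Sym} :=
  match f with
  | Incl _ p a q b | Excl _ p a q b =>
      [fset x | x in tval p] `|` pl_syms a
        `|` ([fset x | x in tval q] `|` pl_syms b)
  | And f1 f2 => free_syms f1 `|` free_syms f2
  end.

Definition evaluation (Sym : choiceType) (D : {fset Sym}) := {ffun D -> bool}.

Definition team (Sym : choiceType) (D : {fset Sym}) := {set evaluation D}.

(* s(p); the value false for p outside D is a dummy, never reached when D
   contains the symbols of the formula being evaluated. *)
Definition value (Sym : choiceType) (D : {fset Sym}) (s : evaluation D)
    (p : Sym) : bool :=
  if insub p is Some x then s x else false.

Definition values (Sym : choiceType) (D : {fset Sym}) (s : evaluation D)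
    (k : nat) (p : k.-tuple Sym) : k.-tuple bool :=
  map_tuple (value s) p.

Fixpoint pl_sat (Sym : choiceType) (D : {fset Sym}) (s : evaluation D)
    (a : pl Sym) : bool :=
  match a with
  | PVar p => value s p
  | PNVar p => ~~ value s p
  | PAnd a1 a2 => pl_sat s a1 && pl_sat s a2
  | POr a1 a2 => pl_sat s a1 || pl_sat s a2
  end.

Fixpoint sat (Sym : choiceType) (D : {fset Sym}) (T : team D)
    (f : form Sym) : Prop :=
  match f with
  | Incl _ p a q b =>
      forall s, s \in T -> pl_sat s a ->
        exists s', [/\ s' \in T, values s' q = values s p & pl_sat s' b]
  | Excl _ p a q b =>
      forall s s', s \in T -> s' \in T -> pl_sat s a -> pl_sat s' b ->
        values s p <> values s' q
  | And f1 f2 => sat T f1 /\ sat T f2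
  end.

Definition form_equiv (Sym : choiceType) (f g : form Sym) : Prop :=
  free_syms f = free_syms g /\
  forall (D : {fset Sym}) (T : team D),
    free_syms f `<=` D -> (sat T f <-> sat T g).

(* Main.v *)
Require Import Defs.
From HB Require Import structures.
From mathcomp Require Import all_boot finmap.

(** Two bit strings of length [k + 1] agree iff their first [k] bits agree and their last bits are
    both 1 or both 0 ([eq_values_rcons]). Moving the last bit into the conditions as a literal of
    the same sign on both sides therefore splits each atom by the value of [p']; [sat_Incl_rcons]
    and [sat_Excl_rcons] carry this out. *)

Lemma eq_values_rcons (Sym : choiceType) (D : {fset Sym}) (s t : evaluation D)
    (k : nat) (p q : k.-tuple Sym) (p' q' : Sym) :
  values s (rcons_tuple p p') = values t (rcons_tuple q q') <->
  values s p = values t q /\ value s p' = value t q'.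
Proof.
split=> [/(congr1 val) /= | [/(congr1 val) /= E E']].
  rewrite !map_rcons => /rcons_inj [E E'].
  by split=> //; apply: val_inj.
by apply: val_inj; rewrite /= !map_rcons E E'.
Qed.

(** It serves the exclusion atoms too: [free_syms] treats [Incl] and [Excl] alike, so the two
    statements are convertible. *)
Lemma free_syms_split (Sym : choiceType) (a b : pl Sym) (k : nat)
    (p q : k.-tuple Sym) (p' q' : Sym) :
  free_syms (Incl (rcons_tuple p p') a (rcons_tuple q q') b) =
  free_syms (And (Incl p (PAnd a (PVar p')) q (PAnd b (PVar q')))
                 (Incl p (PAnd a (PNVar p')) q (PAnd b (PNVar q')))).
Proof.
(* The two conjuncts differ only in the signs of literals, so their symbol sets coincide. *)
rewrite /= fsetUid; apply/fsetP=> x.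
rewrite !inE /= !mem_rcons !inE.
by do ![case: (_ \in _) | case: (_ == _)].
Qed.

Lemma sat_Incl_rcons (Sym : choiceType) (D : {fset Sym}) (T : team D)
    (a b : pl Sym) (k : nat) (p q : k.-tuple Sym) (p' q' : Sym) :
  sat T (Incl (rcons_tuple p p') a (rcons_tuple q q') b) <->
  sat T (And (Incl p (PAnd a (PVar p')) q (PAnd b (PVar q')))
             (Incl p (PAnd a (PNVar p')) q (PAnd b (PNVar q')))).
Proof.
split=> /= [H | [H1 H0] s sT sa].
  (* The witness [t] has at [q'] the bit that [s] has at [p'], so it inherits the literal, whatever
     its sign. *)
  split=> s sT /andP[sa sp]; have [t [tT /eq_values_rcons [E E'] tb]] := H s sT sa;
    by exists t; rewrite tb E'.
(* The bit of [s] at [p'] selects the conjunct; its literal on [q'] then makes the last bits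
   equal. *)
have [sp | sp] := boolP (value s p').
  have [|t [tT E /andP[tb tq]]] := H1 s sT; first by rewrite sa.
  by exists t; split=> //; apply/eq_values_rcons; rewrite sp tq.
have [|t [tT E /andP[tb tq]]] := H0 s sT; first by rewrite sa.
by exists t; split=> //; apply/eq_values_rcons; rewrite (negbTE sp) (negbTE tq).
Qed.

Lemma sat_Excl_rcons (Sym : choiceType) (D : {fset Sym}) (T : team D)
    (a b : pl Sym) (k : nat) (p q : k.-tuple Sym) (p' q' : Sym) :
  sat T (Excl (rcons_tuple p p') a (rcons_tuple q q') b) <->
  sat T (And (Excl p (PAnd a (PVar p')) q (PAnd b (PVar q')))
             (Excl p (PAnd a (PNVar p')) q (PAnd b (PNVar q')))).
Proof.
split=> /= [H | [H1 H0] s t sT tT sa tb /eq_values_rcons [E E']].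
  (* The literals fix both last bits to the same value, so a clash on the first [k] bits extends to
     a clash on all of them. *)
  split=> s t sT tT /andP[sa sp] /andP[tb tq] E; apply: (H s t) => //;
    apply/eq_values_rcons; split=> //.
    by rewrite sp tq.
  by rewrite (negbTE sp) (negbTE tq).
(* By [E'], [s] and [t] satisfy literals of the same sign, so the clashing pair contradicts that
   conjunct. *)
have [sp | sp] := boolP (value s p').
  by apply: (H1 s t) => //; rewrite ?sa ?tb -?E'.
by apply: (H0 s t) => //; rewrite ?sa ?tb -?E'.
Qed.

Theorem proposition4p6 (Sym : choiceType) (a b : pl Sym) (k : nat)
    (p q : k.-tuple Sym) (p' q' : Sym) :
  form_equiv (Incl (rcons_tuple p p') a (rcons_tuple q q') b)
    (And (Incl p (PAnd a (PVar p')) q (PAnd b (PVar q')))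
         (Incl p (PAnd a (PNVar p')) q (PAnd b (PNVar q')))) /\
  form_equiv (Excl (rcons_tuple p p') a (rcons_tuple q q') b)
    (And (Excl p (PAnd a (PVar p')) q (PAnd b (PVar q')))
         (Excl p (PAnd a (PNVar p')) q (PAnd b (PNVar q')))).
Proof.
split; split=> [|D T _].
- exact: free_syms_split.
- exact: sat_Incl_rcons.
- exact: free_syms_split.
- exact: sat_Excl_rcons.
Qed.
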